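(* The Fubini-type polynomials $a_n^{(\alpha)}(x)$ satisfy the recurrence relation $$\sum_{k=0}^{n}\binom{n}{k}\sum_{i=0}^{n-k}\langle 2\alpha\rangle_i(-1)^iS(n-k,i)\,a_k^{(\alpha)}(x)=2^{\alpha}x^{n}.$$ In particular, the Fubini-type numbers $a_n^{(\alpha)}=a_n^{(\alpha)}(0)$ satisfy $$\sum_{k=0}^{n}\binom{n}{k}\sum_{i=0}^{n-k}\langle 2\alpha\rangle_i(-1)^iS(n-k,i)\,a_k^{(\alpha)}=0.$$ In analogy, the generalized Apostol-Euler polynomials $E_n^{(\beta)}(x;\gamma)$, taken with $\beta=2\alpha$ and $\gamma=-1/2$, satisfy the recurrence relation $$\sum_{k=0}^{n}\binom{n}{k}\sum_{i=0}^{n-k}\langle 2\alpha\rangle_i(-1)^iS(n-k,i)\,E_k^{(2\alpha)}(x;-1/2)=2^{4\alpha}x^{n}.$$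
   Context: For $\alpha\in\mathbb{N}_0$ the Fubini-type polynomials $a_n^{(\alpha)}(x)$ are defined by $$\frac{2^{\alpha}}{(2-e^{t})^{2\alpha}}e^{xt}=\sum_{n=0}^{\infty}a_n^{(\alpha)}(x)\frac{t^n}{n!},\qquad |t|<\log 2,$$ and $a_n^{(\alpha)}=a_n^{(\alpha)}(0)$ are the Fubini-type numbers. The generalized Apostol-Euler polynomials $E_n^{(\beta)}(x;\gamma)$ of order $\beta$ are defined (for $t$ near $0$) by $$\left(\frac{2}{\gamma e^{t}+1}\right)^{\beta}e^{xt}=\sum_{n=0}^{\infty}E_n^{(\beta)}(x;\gamma)\frac{t^n}{n!}.$$ The falling factorial is $\langle y\rangle_i=y(y-1)\cdots(y-i+1)$ for $i\ge1$, with $\langle y\rangle_0=1$. $S(n,k)$ are the Stirling numbers of the second kind, generated by $\frac{(e^t-1)^k}{k!}=\sum_{n=k}^{\infty}S(n,k)\frac{t^n}{n!}$.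
   Formalization: The second identity, for the Fubini-type numbers, is stated only for n ≥ 1, because at n = 0 its left-hand side equals a_0 = 2^α, which is not 0. *)

(* Defs.v *)
From Stdlib Require Import Reals Factorial ClassicalEpsilon.
From Coquelicot Require Import Coquelicot.
Open Scope R_scope.

(* F(t) = sum_(n >= 0) c_n t^n / n! *)
Definition egf_at (c : nat -> R) (F : R -> R) (t : R) : Prop :=
  is_series (fun n : nat => c n * (t ^ n / INR (fact n))) (F t).

(* The sequence singled out by a defining generating-function identity [P];
   it carries no information unless some sequence satisfies [P]. *)
Definition the_seq (P : (nat -> R) -> Prop) : nat -> R :=
  epsilon (inhabits (fun _ : nat => 0)) P.

Definition fubini_gf (alpha : nat) (x t : R) : R :=
  2 ^ alpha / (2 - exp t) ^ (2 * alpha) * exp (x * t).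

Definition fubini_poly (alpha n : nat) (x : R) : R :=
  the_seq (fun a => forall t : R, Rabs t < ln 2 ->
                      egf_at a (fubini_gf alpha x) t) n.

Definition fubini_number (alpha n : nat) : R := fubini_poly alpha n 0.

Definition apostol_euler_gf (beta : nat) (gamma x t : R) : R :=
  (2 / (gamma * exp t + 1)) ^ beta * exp (x * t).

Definition apostol_euler (beta n : nat) (x gamma : R) : R :=
  the_seq (fun e => locally 0 (egf_at e (apostol_euler_gf beta gamma x))) n.

Fixpoint falling (y : R) (i : nat) : R :=
  match i with
  | O => 1
  | S j => falling y j * (y - INR j)
  end.

(* The series is indexed from n = 0 rather than n = k, which amounts to
   the usual convention that the value is 0 for n < k. *)
Definition stirling2 (n k : nat) : R :=
  the_seq (fun s => forall t : R,
             egf_at s (fun u => (exp u - 1) ^ k / INR (fact k)) t) n.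

(* Main.v *)
(** Since <2α>_i / i! is a binomial coefficient, the inner sum
    Σ_i <2α>_i (-1)^i S(m,i) is the m-th exponential coefficient of
    (1 - (e^t - 1))^(2α) = (2 - e^t)^(2α).  The left-hand side is thus the n-th
    coefficient of the product of (2 - e^t)^(2α) with the generating function
    of the polynomials, that is, of 2^α e^(xt) or 2^(4α) e^(xt).

    The sequences being given by choice, one must also know that the expansions
    exist, and for the Fubini polynomials on the whole interval |t| < ln 2.
    The coefficients of 1/(2 - e^t) are the ordered Bell numbers F_n; their
    recursion and Σ_(j>=1) (ln 2)^j / j! = 1 give F_n (ln 2)^n <= n!, so the
    radius of convergence is at least ln 2. *)
Require Import Defs.
From Stdlib Require Import Reals.
From Coquelicot Require Import Coquelicot.
From Stdlib Require Import Lra Lia ClassicalEpsilon Factorial PeanoNat.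
Open Scope R_scope.

(** Coquelicot's [is_series_ext] leaves an equation in the carrier of a normed
    module, which [ring] and [field] do not recognise as an equation in [R]. *)
Lemma is_series_ext_R (a b : nat -> R) (l : R) :
  (forall n, a n = b n) -> is_series a l -> is_series b l.
Proof. exact (is_series_ext a b l). Qed.

Lemma the_seq_spec (P : (nat -> R) -> Prop) : (exists a, P a) -> P (the_seq P).
Proof. exact (epsilon_spec _ P). Qed.

(** * Linear operations and basic expansions at a point *)

Lemma egf_at_ext (a b : nat -> R) (F G : R -> R) (t : R) :
  (forall n, a n = b n) -> F t = G t -> egf_at a F t -> egf_at b G t.
Proof.
  unfold egf_at; intros Hab HFG Ha; rewrite <- HFG.
  apply is_series_ext_R with (2 := Ha); intros n; now rewrite Hab.
Qed.

Lemma egf_at_pseries (a : nat -> R) (F : R -> R) (t : R) :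
  egf_at a F t <-> is_pseries (fun n => a n / INR (fact n)) t (F t).
Proof.
  rewrite is_pseries_R; unfold egf_at.
  split; intros H; apply is_series_ext_R with (2 := H); intros n;
    field; apply INR_fact_neq_0.
Qed.

Lemma egf_at_plus (a b : nat -> R) (F G : R -> R) (t : R) :
  egf_at a F t -> egf_at b G t ->
  egf_at (fun n => a n + b n) (fun u => F u + G u) t.
Proof.
  unfold egf_at; intros Ha Hb.
  apply is_series_ext_R with (2 := is_series_plus _ _ _ _ Ha Hb).
  intros n; unfold plus; simpl; ring.
Qed.

Lemma egf_at_scal (w : R) (a : nat -> R) (F : R -> R) (t : R) :
  egf_at a F t -> egf_at (fun n => w * a n) (fun u => w * F u) t.
Proof.
  unfold egf_at; intros Ha.
  apply is_series_ext_R with (2 := is_series_scal_l w _ _ Ha).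
  intros n; unfold scal; simpl; unfold mult; simpl; ring.
Qed.

Lemma egf_at_sum (c : nat -> nat -> R) (F : nat -> R -> R) (N : nat) (t : R) :
  (forall i, egf_at (c i) (F i) t) ->
  egf_at (fun n => sum_f_R0 (fun i => c i n) N)
         (fun u => sum_f_R0 (fun i => F i u) N) t.
Proof.
  intros H; induction N as [|N IHN]; [exact (H O)|].
  exact (egf_at_plus _ _ _ _ _ IHN (H (S N))).
Qed.

Lemma egf_at_exp (x t : R) : egf_at (fun n => x ^ n) (fun u => exp (x * u)) t.
Proof.
  generalize (is_exp_Reals (x * t)); rewrite is_pseries_R; unfold egf_at.
  intros H; apply is_series_ext_R with (2 := H).
  intros n; rewrite Rpow_mult_distr; field; apply INR_fact_neq_0.
Qed.

Lemma egf_at_one (t : R) : egf_at (fun n => 0 ^ n) (fun _ => 1) t.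
Proof.
  apply egf_at_ext with (3 := egf_at_exp 0 t); [easy|].
  now rewrite Rmult_0_l, exp_0.
Qed.

Lemma egf_at_exp_sub1 (t : R) :
  egf_at (fun n => 1 ^ n + (-1) * 0 ^ n) (fun u => exp u - 1) t.
Proof.
  eapply egf_at_ext with
    (3 := egf_at_plus _ _ _ _ _ (egf_at_exp 1 t) (egf_at_scal (-1) _ _ _ (egf_at_one t)));
    [easy|].
  rewrite Rmult_1_l; ring.
Qed.

Lemma egf_at_two_sub_exp (t : R) :
  egf_at (fun n => 2 * 0 ^ n + (-1) * 1 ^ n) (fun u => 2 - exp u) t.
Proof.
  eapply egf_at_ext with
    (3 := egf_at_plus _ _ _ _ _ (egf_at_scal 2 _ _ _ (egf_at_one t))
            (egf_at_scal (-1) _ _ _ (egf_at_exp 1 t))); [easy|].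
  rewrite Rmult_1_l; ring.
Qed.

(** * Expansions on a symmetric interval: convergence, uniqueness, products *)

Definition egf_on (r : R) (a : nat -> R) (F : R -> R) : Prop :=
  forall t, Rabs t < r -> egf_at a F t.

Lemma egf_on_weaken (r s : R) (a : nat -> R) (F : R -> R) :
  r <= s -> egf_on s a F -> egf_on r a F.
Proof. intros Hrs H t Ht; apply H; lra. Qed.

Lemma egf_on_locally (a : nat -> R) (F : R -> R) :
  locally 0 (egf_at a F) -> exists r, 0 < r /\ egf_on r a F.
Proof.
  intros [e He]; exists e; split; [apply cond_pos|].
  intros t Ht; apply He.
  change (Rabs (t - 0) < e); now rewrite Rminus_0_r.
Qed.

Lemma locally_egf_on (r : R) (a : nat -> R) (F : R -> R) :
  0 < r -> egf_on r a F -> locally 0 (egf_at a F).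
Proof.
  intros Hr H; exists (mkposreal r Hr); intros t Ht; apply H.
  change (Rabs (t - 0) < r) in Ht; now rewrite Rminus_0_r in Ht.
Qed.

Lemma egf_on_CV_radius (r : R) (a : nat -> R) (F : R -> R) (t : R) :
  egf_on r a F -> Rabs t < r ->
  Rbar_lt (Rabs t) (CV_radius (fun n => a n / INR (fact n))).
Proof.
  intros H Ht; apply Rbar_not_le_lt; intros Hle.
  pose proof (Rabs_pos t) as H0.
  assert (Hs : Rabs ((Rabs t + r) / 2) = (Rabs t + r) / 2)
    by (apply Rabs_pos_eq; lra).
  (* The midpoint of |t| and r is still in the interval, so the terms there tend to 0; outside the
     disk of convergence they cannot. *)
  apply (CV_disk_outside (fun n => a n / INR (fact n)) ((Rabs t + r) / 2)).
  - apply Rbar_le_lt_trans with (1 := Hle); simpl; lra.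
  - apply ex_series_lim_0; exists (F ((Rabs t + r) / 2)).
    apply is_pseries_R, egf_at_pseries, H; lra.
Qed.

Lemma egf_on_abs (r : R) (a : nat -> R) (F : R -> R) (t : R) :
  egf_on r a F -> Rabs t < r ->
  ex_series (fun n => Rabs (a n * (t ^ n / INR (fact n)))).
Proof.
  intros H Ht.
  generalize (CV_disk_inside _ _ (egf_on_CV_radius r a F t H Ht)).
  apply ex_series_ext; intros n; f_equal; field; apply INR_fact_neq_0.
Qed.

(** This pins down the sequences obtained by choice: any two expansions of one function near 0 have
    the same coefficients. *)
Lemma egf_on_unique (r : R) (a b : nat -> R) (F : R -> R) (n : nat) :
  0 < r -> egf_on r a F -> egf_on r b F -> a n = b n.
Proof.
  intros Hr Ha Hb.
  assert (H : a n / INR (fact n) = b n / INR (fact n)).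
  { apply (PSeries_ext_recip (fun n => a n / INR (fact n))
                             (fun n => b n / INR (fact n))).
    - rewrite <- Rabs_R0; apply (egf_on_CV_radius r _ F); [easy|].
      now rewrite Rabs_R0.
    - rewrite <- Rabs_R0; apply (egf_on_CV_radius r _ F); [easy|].
      now rewrite Rabs_R0.
    - generalize (filter_and _ _ (locally_egf_on r a F Hr Ha)
                                 (locally_egf_on r b F Hr Hb)).
      apply filter_imp; intros t [Hat Hbt].
      rewrite egf_at_pseries in Hat, Hbt.
      now rewrite (is_pseries_unique _ _ _ Hat), (is_pseries_unique _ _ _ Hbt). }
  pose proof (INR_fact_neq_0 n).
  apply Rmult_eq_reg_r with (/ INR (fact n)); [exact H|].
  now apply Rinv_neq_0_compat.
Qed.

Definition binomial_conv (c a : nat -> R) (n : nat) : R :=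
  sum_f_R0 (fun k => Binomial.C n k * c (n - k)%nat * a k) n.

(** Cauchy product, legitimate by absolute convergence inside the interval; 1/(k! (n-k)!) =
    C(n,k)/n! produces the binomial weight. *)
Lemma egf_on_mult (r : R) (c a : nat -> R) (G F : R -> R) :
  egf_on r c G -> egf_on r a F ->
  egf_on r (binomial_conv c a) (fun t => G t * F t).
Proof.
  intros Hc Ha t Ht; unfold egf_at; rewrite Rmult_comm.
  apply is_series_ext_R with
    (2 := is_series_mult _ _ _ _ (Ha t Ht) (Hc t Ht)
            (egf_on_abs _ _ _ _ Ha Ht) (egf_on_abs _ _ _ _ Hc Ht)).
  intros n; unfold binomial_conv; rewrite Rmult_comm, scal_sum.
  apply sum_eq; intros k Hk.
  replace (t ^ n) with (t ^ k * t ^ (n - k)) by (rewrite <- pow_add; f_equal; lia).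
  unfold Binomial.C; field; repeat split; apply INR_fact_neq_0.
Qed.

(** * Stirling numbers and the expansion of (2 - e^t)^m *)

Lemma sum_f_R0_zero (f : nat -> R) (n : nat) :
  (forall k, (k <= n)%nat -> f k = 0) -> sum_f_R0 f n = 0.
Proof.
  intros H; rewrite (sum_eq f (fun _ => 0) n H), sum_cte; ring.
Qed.

Lemma sum_f_R0_truncate (f : nat -> R) (m n : nat) :
  (m <= n)%nat -> (forall k, (m < k)%nat -> f k = 0) ->
  sum_f_R0 f n = sum_f_R0 f m.
Proof.
  intros Hmn Hf; induction Hmn as [|n Hmn IH]; [easy|].
  rewrite tech5, IH, Hf by lia; ring.
Qed.

(** Induction on k, multiplying by (e^t - 1)/(k+1); the vanishing below k is carried along because
    e^t - 1 has no constant term. *)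
Lemma stirling2_egf_exists (k : nat) :
  exists s, (forall n, (n < k)%nat -> s n = 0) /\
    forall t, egf_at s (fun u => (exp u - 1) ^ k / INR (fact k)) t.
Proof.
  induction k as [|k [s [Hs0 Hs]]].
  - exists (fun n => 0 ^ n); split; [lia|]; intros t.
    apply egf_at_ext with (3 := egf_at_one t); [easy|]; simpl; field.
  - exists (fun n => / INR (S k) *
              binomial_conv (fun n => 1 ^ n + (-1) * 0 ^ n) s n); split.
    + intros n Hn; unfold binomial_conv; rewrite sum_f_R0_zero; [ring|].
      (* Here j <= n <= k. If j = k then n = k and the coefficient of e^t - 1 has index 0; otherwise
         [s j] vanishes. *)
      intros j Hj; destruct (Nat.eq_dec j k) as [->|Hjk].
      * replace (n - k)%nat with O by lia; simpl; ring.
      * rewrite (Hs0 j) by lia; ring.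
    + intros t.
      assert (Hmul : egf_on (Rabs t + 1)
                (binomial_conv (fun n => 1 ^ n + (-1) * 0 ^ n) s)
                (fun u => (exp u - 1) * ((exp u - 1) ^ k / INR (fact k)))).
      { apply egf_on_mult; intros u _; [apply egf_at_exp_sub1 | apply Hs]. }
      eapply egf_at_ext with (3 := egf_at_scal (/ INR (S k)) _ _ _ (Hmul t _));
        [easy|].
      cbv beta; rewrite fact_simpl, mult_INR; simpl pow.
      field; split; [apply INR_fact_neq_0 | apply not_0_INR; lia].
      Unshelve. lra.
Qed.

Lemma stirling2_egf (k : nat) (t : R) :
  egf_at (fun n => stirling2 n k) (fun u => (exp u - 1) ^ k / INR (fact k)) t.
Proof.
  revert t; apply (the_seq_spec (fun s => forall t : R,
    egf_at s (fun u => (exp u - 1) ^ k / INR (fact k)) t)).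
  destruct (stirling2_egf_exists k) as [s [_ Hs]]; now exists s.
Qed.

Lemma stirling2_small (n k : nat) : (n < k)%nat -> stirling2 n k = 0.
Proof.
  intros Hnk; destruct (stirling2_egf_exists k) as [s [Hs0 Hs]].
  rewrite <- (Hs0 n Hnk).
  apply (egf_on_unique 1 (fun n => stirling2 n k) s
           (fun u => (exp u - 1) ^ k / INR (fact k)) n Rlt_0_1); intros t _;
    [apply stirling2_egf | apply Hs].
Qed.

Lemma falling_fact (m i : nat) :
  (i <= m)%nat -> falling (INR m) i * INR (fact (m - i)) = INR (fact m).
Proof.
  induction i as [|i IHi]; intros Hi; simpl falling.
  - rewrite Nat.sub_0_r; ring.
  - rewrite <- IHi by lia.
    replace (m - i)%nat with (S (m - S i)) by lia.
    rewrite fact_simpl, mult_INR.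
    replace (S (m - S i)) with (m - i)%nat by lia.
    rewrite minus_INR by lia; ring.
Qed.

(** The factor m - m enters at i = m + 1 and stays. *)
Lemma falling_small (m i : nat) : (m < i)%nat -> falling (INR m) i = 0.
Proof.
  induction 1 as [|i _ IHi]; simpl; [ring | rewrite IHi; ring].
Qed.

Lemma falling_binomial (m : nat) (z : R) :
  sum_f_R0 (fun i => falling (INR m) i * (z ^ i / INR (fact i))) m = (1 + z) ^ m.
Proof.
  rewrite Rplus_comm, binomial; apply sum_eq; intros i Hi.
  rewrite pow1; unfold Binomial.C; rewrite <- (falling_fact m i Hi).
  field; split; apply INR_fact_neq_0.
Qed.

Definition falling_stirling (m n : nat) : R :=
  sum_f_R0 (fun i => falling (INR m) i * (-1) ^ i * stirling2 n i) n.

Lemma falling_stirling_egf (m : nat) (t : R) :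
  egf_at (falling_stirling m) (fun u => (2 - exp u) ^ m) t.
Proof.
  eapply egf_at_ext with
    (3 := egf_at_sum _ _ m t (fun i =>
            egf_at_scal (falling (INR m) i * (-1) ^ i) _ _ t (stirling2_egf i t))).
  - intros n; unfold falling_stirling.
    (* The binomial theorem sums up to m, the definition up to n: the terms in between vanish
       through the falling factorial if m <= n, through the Stirling number if n <= m. *)
    destruct (Nat.le_ge_cases m n) as [H|H].
    + symmetry; apply sum_f_R0_truncate; [easy|]; intros k Hk.
      rewrite falling_small by easy; ring.
    + apply sum_f_R0_truncate; [easy|]; intros k Hk.
      rewrite stirling2_small by easy; ring.
  - cbv beta; replace (2 - exp t) with (1 + (-1) * (exp t - 1)) by ring.
    rewrite <- falling_binomial; apply sum_eq; intros i _.
    rewrite Rpow_mult_distr; field; apply INR_fact_neq_0.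
Qed.

(** * Ordered Bell numbers *)

(** [ordered_bell_upto n k] is the [k]-th ordered Bell number for [k <= n]
    only; keeping the whole table makes the course-of-values recursion
    structural. *)
Fixpoint ordered_bell_upto (n : nat) : nat -> R :=
  match n with
  | O => fun _ => 1
  | S m => fun k =>
      if (k <=? m)%nat then ordered_bell_upto m k
      else sum_f_R0 (fun j => Binomial.C (S m) j * ordered_bell_upto m j) m
  end.

Definition ordered_bell (n : nat) : R := ordered_bell_upto n n.

Lemma ordered_bell_upto_diag (n k : nat) :
  (k <= n)%nat -> ordered_bell_upto n k = ordered_bell k.
Proof.
  induction n as [|n IHn]; intros Hk.
  - now replace k with O by lia.
  - destruct (Nat.eq_dec k (S n)) as [->|Hne]; [easy|].
    cbn [ordered_bell_upto]; destruct (Nat.leb_spec k n); [now apply IHn | lia].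
Qed.

Lemma ordered_bell_S (n : nat) :
  ordered_bell (S n) = sum_f_R0 (fun j => Binomial.C (S n) j * ordered_bell j) n.
Proof.
  unfold ordered_bell at 1; cbn [ordered_bell_upto].
  destruct (Nat.leb_spec (S n) n); [lia|].
  apply sum_eq; intros j Hj; now rewrite ordered_bell_upto_diag.
Qed.

(** The recursion with all terms on one side: 2 - e^t has coefficient 1 at index 0 and -1 at every
    other index. *)
Lemma ordered_bell_conv (n : nat) :
  binomial_conv (fun n => 2 * 0 ^ n + (-1) * 1 ^ n) ordered_bell n = 0 ^ n.
Proof.
  unfold binomial_conv; destruct n as [|n].
  - unfold ordered_bell, Binomial.C; simpl; field.
  - rewrite tech5, Nat.sub_diag, ordered_bell_S, (pow_i (S n)) by lia.
    rewrite (sum_eq _ (fun j => Binomial.C (S n) j * ordered_bell j * (-1))).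
    + rewrite <- scal_sum; unfold Binomial.C at 2.
      rewrite Nat.sub_diag; simpl (fact 0); simpl pow; rewrite INR_1.
      field; apply INR_fact_neq_0.
    + intros j Hj; rewrite pow_i, pow1 by lia; ring.
Qed.

(** * Growth of the ordered Bell numbers and the expansion of 1/(2 - e^t) *)

Lemma ln2_pos : 0 < ln 2.
Proof. rewrite <- ln_1; apply ln_increasing; lra. Qed.

Lemma sum_ln2_pow_le (n : nat) :
  sum_f_R0 (fun j => ln 2 ^ S j / INR (fact (S j))) n <= 1.
Proof.
  pose proof ln2_pos as Hpos.
  (* Partial sums of e^(ln 2) = 2; removing the term 1 at j = 0 leaves the bound 1. *)
  assert (H : sum_f_R0 (fun j => ln 2 ^ j / INR (fact j)) (S n) <= 2).
  { apply sum_incr.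
    - apply is_series_Reals.
      generalize (egf_at_exp 1 (ln 2)); unfold egf_at.
      rewrite Rmult_1_l, exp_ln by lra.
      apply is_series_ext_R; intros j; rewrite pow1; ring.
    - intros j; apply Rdiv_le_0_compat; [apply pow_le; lra | apply INR_fact_lt_0]. }
  rewrite decomp_sum in H by lia; simpl in H; simpl; lra.
Qed.

Lemma sum_f_R0_rev (f : nat -> R) (n : nat) :
  sum_f_R0 (fun k => f (n - k)%nat) n = sum_f_R0 f n.
Proof.
  induction n as [|n IHn]; [easy|].
  rewrite (decomp_sum (fun k => f (S n - k)%nat)) by lia.
  simpl pred; rewrite (tech5 f), <- IHn, Nat.sub_0_r, Rplus_comm; easy.
Qed.

Lemma ordered_bell_bound (n : nat) :
  0 <= ordered_bell n * (ln 2 ^ n / INR (fact n)) <= 1.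
Proof.
  pose proof ln2_pos as Hpos.
  induction n as [[|n] IH] using (well_founded_induction Nat.lt_wf_0).
  - unfold ordered_bell; simpl; lra.
  - set (w := fun j => ln 2 ^ S j / INR (fact (S j))).
    set (f := fun j => ordered_bell j * (ln 2 ^ j / INR (fact j))) in *.
    assert (Hw : forall j, 0 <= w j).
    { intros j; apply Rdiv_le_0_compat; [apply pow_le; lra | apply INR_fact_lt_0]. }
    (* After normalisation the recursion is a plain convolution with the weights [w], whose sum is
       at most 1, so bounds by 1 propagate. *)
    assert (E : ordered_bell (S n) * (ln 2 ^ S n / INR (fact (S n)))
                = sum_f_R0 (fun j => f j * w (n - j)%nat) n).
    { rewrite ordered_bell_S, Rmult_comm, scal_sum; apply sum_eq; intros j Hj.
      unfold f, w, Binomial.C; replace (S n - j)%nat with (S (n - j)) by lia.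
      replace (ln 2 ^ S n) with (ln 2 ^ j * ln 2 ^ S (n - j))
        by (rewrite <- pow_add; f_equal; lia).
      field; repeat split; apply INR_fact_neq_0. }
    rewrite E; split.
    + rewrite <- (sum_f_R0_zero (fun _ => 0) n) by easy.
      apply sum_Rle; intros j Hj.
      apply Rmult_le_pos; [apply IH; lia | apply Hw].
    + apply Rle_trans with (2 := sum_ln2_pow_le n).
      fold w; rewrite <- (sum_f_R0_rev w); apply sum_Rle; intros j Hj.
      rewrite <- (Rmult_1_l (w (n - j)%nat)) at 2.
      apply Rmult_le_compat_r; [apply Hw | apply IH; lia].
Qed.

Lemma ordered_bell_converges (t : R) :
  Rabs t < ln 2 -> ex_series (fun n => ordered_bell n * (t ^ n / INR (fact n))).
Proof.
  intros Ht; pose proof ln2_pos as Hpos.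
  (* Comparison with the geometric series of ratio |t| / ln 2 < 1. *)
  apply (ex_series_le (K := R_AbsRing) (V := R_CompleteNormedModule) _
           (fun n => (Rabs t / ln 2) ^ n)).
  - intros n; change (norm ?x) with (Rabs x).
    replace (ordered_bell n * (t ^ n / INR (fact n)))
      with (ordered_bell n * (ln 2 ^ n / INR (fact n)) * (t / ln 2) ^ n).
    + rewrite Rabs_mult, <- RPow_abs, Rabs_div, (Rabs_pos_eq (ln 2)) by lra.
      rewrite Rabs_pos_eq by apply ordered_bell_bound.
      rewrite <- (Rmult_1_l ((Rabs t / ln 2) ^ n)) at 2.
      apply Rmult_le_compat_r; [|apply ordered_bell_bound].
      apply pow_le, Rdiv_le_0_compat; [apply Rabs_pos | easy].
    + replace ((t / ln 2) ^ n) with (t ^ n * / ln 2 ^ n)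
        by now rewrite <- pow_inv, <- Rpow_mult_distr.
      field; split; [apply INR_fact_neq_0 | apply pow_nonzero; lra].
  - eexists; apply is_series_geom.
    rewrite Rabs_div, Rabs_Rabsolu, (Rabs_pos_eq (ln 2)) by lra.
    apply Rlt_div_l; lra.
Qed.

Lemma two_sub_exp_neq_0 (t : R) : Rabs t < ln 2 -> 2 - exp t <> 0.
Proof.
  intros Ht; pose proof (Rle_abs t).
  assert (exp t < exp (ln 2)) by (apply exp_increasing; lra).
  rewrite exp_ln in *; lra.
Qed.

Lemma ordered_bell_egf : egf_on (ln 2) ordered_bell (fun t => / (2 - exp t)).
Proof.
  set (L := fun t => Series (fun n => ordered_bell n * (t ^ n / INR (fact n)))).
  assert (HL : egf_on (ln 2) ordered_bell L)
    by (intros t Ht; apply Series_correct, ordered_bell_converges, Ht).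
  intros t Ht; apply egf_at_ext with (3 := HL t Ht); [easy|].
  (* The product series has the coefficients [0 ^ n] of the constant 1, so the sum [L] inverts 2 -
     e^t. *)
  assert (H1 : (2 - exp t) * L t = 1).
  { assert (H : egf_on (ln 2) _ _)
      by exact (egf_on_mult _ _ _ _ _ (fun u _ => egf_at_two_sub_exp u) HL).
    specialize (H t Ht); pose proof (egf_at_one t) as H0.
    unfold egf_at in H, H0.
    apply is_series_unique in H, H0.
    apply (eq_trans (eq_sym H)); apply eq_trans with (2 := H0).
    apply Series_ext; intros n; now rewrite ordered_bell_conv. }
  pose proof (two_sub_exp_neq_0 t Ht) as Hne.
  apply Rmult_eq_reg_l with (2 - exp t); [|easy].
  rewrite H1; now field.
Qed.

(** * Existence of both polynomial families and the recurrences *)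

Lemma inv_two_sub_exp_pow_egf (w x : R) (m : nat) :
  exists a, egf_on (ln 2) a (fun t => w / (2 - exp t) ^ m * exp (x * t)).
Proof.
  induction m as [|m [a Ha]].
  - exists (fun n => w * x ^ n); intros t _.
    apply egf_at_ext with (3 := egf_at_scal w _ _ _ (egf_at_exp x t)); [easy|].
    simpl; field.
  - exists (binomial_conv ordered_bell a); intros t Ht.
    apply egf_at_ext with (3 := egf_on_mult _ _ _ _ _ ordered_bell_egf Ha t Ht);
      [easy|].
    pose proof (two_sub_exp_neq_0 t Ht); simpl; field.
    split; [now apply pow_nonzero | easy].
Qed.

(** Multiplying by (2 - e^t)^m leaves w e^(xt), and coefficients are compared. The radius r is
    arbitrary because the Apostol-Euler expansion is only known near 0; cutting it to at most ln 2
    keeps the denominator nonzero. *)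
Lemma falling_stirling_recurrence (r w x : R) (m n : nat) (a : nat -> R) :
  0 < r ->
  egf_on r a (fun t => w / (2 - exp t) ^ m * exp (x * t)) ->
  binomial_conv (falling_stirling m) a n = w * x ^ n.
Proof.
  intros Hr Ha; pose proof ln2_pos as Hpos.
  pose proof (Rmin_l r (ln 2)) as Hl; pose proof (Rmin_r r (ln 2)) as Hr'.
  apply (egf_on_unique (Rmin r (ln 2)) _ (fun n => w * x ^ n)
           (fun t => w * exp (x * t)) n).
  - now apply Rmin_glb_lt.
  - intros t Ht.
    apply egf_at_ext with
      (3 := egf_on_mult _ _ _ _ _ (fun u _ => falling_stirling_egf m u)
              (egf_on_weaken _ _ _ _ Hl Ha) t Ht); [easy|].
    cbv beta; field; apply pow_nonzero, two_sub_exp_neq_0; lra.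
  - intros t _; apply egf_at_scal, egf_at_exp.
Qed.

Lemma fubini_poly_egf (alpha : nat) (x : R) :
  egf_on (ln 2) (fun n => fubini_poly alpha n x) (fubini_gf alpha x).
Proof.
  exact (the_seq_spec (fun a => egf_on (ln 2) a (fubini_gf alpha x))
           (inv_two_sub_exp_pow_egf (2 ^ alpha) x (2 * alpha))).
Qed.

Lemma apostol_euler_gf_half (beta : nat) (x t : R) :
  Rabs t < ln 2 ->
  apostol_euler_gf beta (- 1 / 2) x t = 4 ^ beta / (2 - exp t) ^ beta * exp (x * t).
Proof.
  intros Ht; pose proof (two_sub_exp_neq_0 t Ht) as Hne.
  unfold apostol_euler_gf; f_equal.
  replace (2 / (- 1 / 2 * exp t + 1)) with (4 * / (2 - exp t)) by (field; lra).
  now rewrite Rpow_mult_distr, pow_inv.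
Qed.

Lemma apostol_euler_half_egf (beta : nat) (x : R) :
  exists r, 0 < r /\
    egf_on r (fun n => apostol_euler beta n x (- 1 / 2))
      (fun t => 4 ^ beta / (2 - exp t) ^ beta * exp (x * t)).
Proof.
  pose proof ln2_pos as Hpos.
  destruct (egf_on_locally (fun n => apostol_euler beta n x (- 1 / 2))
              (apostol_euler_gf beta (- 1 / 2) x)) as [r [Hr H]].
  - apply (the_seq_spec (fun e =>
             locally 0 (egf_at e (apostol_euler_gf beta (- 1 / 2) x)))).
    destruct (inv_two_sub_exp_pow_egf (4 ^ beta) x beta) as [a Ha]; exists a.
    apply locally_egf_on with (1 := Hpos); intros t Ht.
    apply egf_at_ext with (3 := Ha t Ht); [easy|].
    now rewrite apostol_euler_gf_half.
  - pose proof (Rmin_l r (ln 2)) as Hl; pose proof (Rmin_r r (ln 2)) as Hr'.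
    exists (Rmin r (ln 2)); split; [now apply Rmin_glb_lt|]; intros t Ht.
    apply egf_at_ext with (a := fun n => apostol_euler beta n x (- 1 / 2))
                          (F := apostol_euler_gf beta (- 1 / 2) x); [easy| |].
    + apply apostol_euler_gf_half; lra.
    + apply H; lra.
Qed.

(* [Binomial.C] is qualified because Coquelicot's [C] is the complex numbers. *)
Theorem theorem3p3 (alpha : nat) :
  (forall (n : nat) (x : R),
     sum_f_R0 (fun k : nat =>
       Binomial.C n k *
       sum_f_R0 (fun i : nat =>
         falling (INR (2 * alpha)) i * (-1) ^ i * stirling2 (n - k) i) (n - k) *
       fubini_poly alpha k x) n
     = 2 ^ alpha * x ^ n) /\
  (forall n : nat, (1 <= n)%nat ->
     sum_f_R0 (fun k : nat =>
       Binomial.C n k *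
       sum_f_R0 (fun i : nat =>
         falling (INR (2 * alpha)) i * (-1) ^ i * stirling2 (n - k) i) (n - k) *
       fubini_number alpha k) n
     = 0) /\
  (forall (n : nat) (x : R),
     sum_f_R0 (fun k : nat =>
       Binomial.C n k *
       sum_f_R0 (fun i : nat =>
         falling (INR (2 * alpha)) i * (-1) ^ i * stirling2 (n - k) i) (n - k) *
       apostol_euler (2 * alpha) k x (- 1 / 2)) n
     = 2 ^ (4 * alpha) * x ^ n).
Proof.
  assert (Hfub : forall n x,
            binomial_conv (falling_stirling (2 * alpha))
              (fun k => fubini_poly alpha k x) n = 2 ^ alpha * x ^ n)
    by (intros n x; exact (falling_stirling_recurrence _ _ _ _ _ _ ln2_pos
                             (fubini_poly_egf alpha x))).
  repeat split; [exact Hfub | |].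
  (* The condition 1 <= n makes [0 ^ n] vanish; at n = 0 the value is 2^alpha. *)
  - intros n Hn; transitivity (2 ^ alpha * 0 ^ n); [exact (Hfub n 0)|].
    rewrite pow_i by lia; ring.
  - intros n x; destruct (apostol_euler_half_egf (2 * alpha) x) as [r [Hr H]].
    replace (2 ^ (4 * alpha)) with (4 ^ (2 * alpha))
      by (replace 4 with (2 ^ 2) by ring; rewrite <- pow_mult; f_equal; lia).
    exact (falling_stirling_recurrence _ _ _ _ _ _ Hr H).
Qed.
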